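(* Let $(\Omega,\mathcal F)$ be a measurable space and let $\mathcal P,\mathcal Q\subset\mathcal M_1$ be nonempty. Suppose there is a $\sigma$-finite measure $\gamma$ on $(\Omega,\mathcal F)$ such that $\mu\ll\gamma$ and $\nu\ll\gamma$ for all $\mu\in\mathcal P$, $\nu\in\mathcal Q$. Then $$\mathrm d_{\mathrm{TV}}\big(\overline{\mathrm{co}}(\mathcal P),\overline{\mathrm{co}}(\mathcal Q)\big)=\mathrm d_{\mathrm{TV}}\big(\overline{\mathrm{co}}^*(\mathcal P),\overline{\mathrm{co}}^*(\mathcal Q)\big).$$ Moreover, the minimax risk is attained by a minimax optimal test: there exists $\phi^*\in\Phi$ with $R(\phi^*,\mathcal P,\mathcal Q)=R(\mathcal P,\mathcal Q)$.
   Context: $\mathcal M_1$ is the set of all countably additive probability measures on $(\Omega,\mathcal F)$. A test is an $\mathcal F$-measurable function $\phi:\Omega\to[0,1]$; $\Phi$ is the set of all tests. The risk of a test is $R(\phi,\mathcal P,\mathcal Q)=\sup_{\mu\in\mathcal P}\mathbb E_\mu[\phi]+\sup_{\nu\in\mathcal Q}\mathbb E_\nu[1-\phi]$ and the minimax risk is $R(\mathcal P,\mathcal Q)=\inf_{\phi\in\Phi}R(\phi,\mathcal P,\mathcal Q)$. $\mathcal L$ is the Banach space of bounded measurable real functions on $\Omega$ with the supremum norm. $\mathsf{ba}$ is the space of bounded finitely additive real-valued set functions on $\mathcal F$, with norm $\|\mu\|_{\mathrm{TV}}=\sup_\pi\sum_{A\in\pi}|\mu(A)|$ (supremum over finite measurable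 partitions $\pi$ of $\Omega$); it is the dual of $\mathcal L$ via $\mathbb E_\mu[f]=\int f\,d\mu$ (integral of simple functions extended by uniform limits). $\mathsf{ba}_1$ is the set of nonnegative elements of $\mathsf{ba}$ with $\mu(\Omega)=1$; $\mathcal M_1\subset\mathsf{ba}_1$. The weak-$*$ topology on $\mathsf{ba}$ is the weakest topology making $\mu\mapsto\mathbb E_\mu[f]$ continuous for all $f\in\mathcal L$. $\mathrm{co}(\mathcal P)$ is the convex hull, $\overline{\mathrm{co}}(\mathcal P)$ is its closure in total-variation norm, and $\overline{\mathrm{co}}^*(\mathcal P)$ is its weak-$*$ closure in $\mathsf{ba}$. For $\mu,\nu\in\mathsf{ba}_1$, $\mathrm d_{\mathrm{TV}}(\mu,\nu)=\tfrac12\|\mu-\nu\|_{\mathrm{TV}}=\sup_{\phi\in\Phi}(\mathbb E_\mu[\phi]-\mathbb E_\nu[\phi])$; for nonempty $S,T\subset\mathsf{ba}_1$, $\mathrm d_{\mathrm{TV}}(S,T)=\inf_{\mu\in S,\nu\in T}\mathrm d_{\mathrm{TV}}(\mu,\nu)$. *)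

(* Defs.v *)
From HB Require Import structures.
From mathcomp Require Import all_boot all_order all_algebra.
From mathcomp Require Import all_classical all_reals all_analysis.

Set Implicit Arguments.
Unset Strict Implicit.
Unset Printing Implicit Defensive.

Import Order.TTheory GRing.Theory Num.Theory.
Import numFieldNormedType.Exports.

Local Open Scope classical_set_scope.
Local Open Scope ring_scope.

Section ba.
Context d (T : measurableType d) (R : realType).

(* Set functions live on all of [set T]; requiring the value 0 off the
   sigma-algebra makes equality in [ba] coincide with equality on measurable
   sets, so that the total variation is a norm and not just a seminorm. *)
Definition is_ba (mu : set T -> R^o) : Prop :=
  [/\ forall A B, measurable A -> measurable B -> A `&` B = set0 ->
        mu (A `|` B) = mu A + mu B,
      exists C : R, forall A, measurable A -> `|mu A| <= C
    & forall A, ~ measurable A -> mu A = 0].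

Definition ba_pred : {pred set T -> R^o} := fun mu => `[< is_ba mu >].

Record ba : Type := Ba { ba_val :> set T -> R^o ; ba_valP : ba_val \in ba_pred }.

HB.instance Definition _ := [isSub for ba_val].
HB.instance Definition _ := [Choice of ba by <:].

Lemma baP (mu : ba) : is_ba mu.
Proof. by have /asboolP := ba_valP mu. Qed.

Lemma ba_submod_closed : submod_closed ba_pred.
Proof.
split.
  apply/asboolP; split => //; first by move=> *; rewrite /= addr0.
  by exists 0 => A _; rewrite /= normr0.
move=> a u v /asboolP[ua [Cu hu] u0] /asboolP[va [Cv hv] v0].
apply/asboolP; split.
- move=> A B mA mB AB; rewrite !fctE ua// va// scalerDr -!addrA; congr (_ + _).
  by rewrite addrCA.
- exists (`|a| * Cu + Cv) => A mA.
  rewrite !fctE (le_trans (ler_normD _ _))// lerD ?hv//.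
  by rewrite normrM ler_wpM2l// hu.
- by move=> A nA; rewrite !fctE u0// v0// scaler0 addr0.
Qed.

HB.instance Definition _ := GRing.isSubmodClosed.Build _ _ ba_pred
  ba_submod_closed.
HB.instance Definition _ := [SubChoice_isSubLmodule of ba by <:].

Lemma baD (mu nu : ba) A : (mu + nu) A = mu A + nu A.
Proof. by []. Qed.

Lemma baZ (a : R) (mu : ba) A : (a *: mu) A = a * mu A.
Proof. by []. Qed.

Lemma ba_eq (mu nu : ba) : (forall A, measurable A -> mu A = nu A) -> mu = nu.
Proof.
move=> h; apply/val_inj/funext => A /=.
have [/h//|nA] := pselect (measurable A).
by have [_ _ ->//] := baP mu; have [_ _ ->] := baP nu.
Qed.

Lemma ba_set0 (mu : ba) : mu set0 = 0.
Proof.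
have [+ _ _] := baP mu.
move=> /(_ set0 set0 measurable0 measurable0 (setI0 _)).
by rewrite setU0 => /eqP; rewrite -subr_eq subrr => /eqP <-.
Qed.

Definition tv_sums (mu : set T -> R) : set R :=
  [set r | exists n (F : 'I_n -> set T),
    [/\ forall i, measurable (F i), trivIset [set: 'I_n] F,
        \bigcup_i F i = [set: T] & r = \sum_(i < n) `|mu (F i)|]].

Definition tv_norm (mu : set T -> R) : R := sup (tv_sums mu).

Lemma ba_bigsetU (mu : ba) n (F : 'I_n -> set T) (P : pred 'I_n) :
  (forall i, measurable (F i)) -> trivIset [set: 'I_n] F ->
  mu (\big[setU/set0]_(i < n | P i) F i) = \sum_(i < n | P i) mu (F i).
Proof.
move=> mF tF; have [add _ _] := baP mu.
rewrite -big_filter -[RHS]big_filter.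
have : uniq [seq i <- index_enum 'I_n | P i].
  by rewrite filter_uniq// index_enum_uniq.
elim: [seq i <- _ | _] => [|i s IH] /=; first by rewrite !big_nil ba_set0.
move=> /andP[si us]; rewrite !big_cons add ?IH//.
  by apply: bigsetU_measurable => j _.
apply/seteqP; split => // x [Fix].
rewrite -bigcup_seq => -[j /= js Fjx].
have ij : i = j by apply: (tF i j) => //; exists x.
by move: si; rewrite ij js.
Qed.

Lemma tv_sums_has_sup (mu : ba) : has_sup (tv_sums mu).
Proof.
split.
  exists (\sum_(i < 1) `|mu ((fun=> setT) i)|), 1%N, (fun=> setT); split => //.
    by move=> i j _ _ _; rewrite (ord1 i) (ord1 j).
  by apply/seteqP; split => // x _; exists ord0.
have [_ [C hC] _] := baP mu.
exists (C + C) => _ [n [F [mF tF _ ->]]].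
rewrite (bigID (fun i => 0 <= mu (F i)))/=; apply: lerD.
  rewrite (eq_bigr (fun i => mu (F i))) => [|i /ger0_norm//].
  rewrite -ba_bigsetU//; apply: (le_trans (ler_norm _)); apply: hC.
  exact: bigsetU_measurable.
rewrite (eq_bigr (fun i => - mu (F i))) => [|i]; last first.
  by rewrite -ltNge => /ltr0_norm.
rewrite sumrN -ba_bigsetU//.
apply: (le_trans (ler_norm _)); rewrite normrN; apply: hC.
exact: bigsetU_measurable.
Qed.

Lemma tv_norm_ub (mu : ba) r : tv_sums mu r -> r <= tv_norm mu.
Proof. by move=> h; apply: sup_ubound => //; case: (tv_sums_has_sup mu). Qed.

Lemma tv_norm_le (mu : ba) M :
  (forall r, tv_sums mu r -> r <= M) -> tv_norm mu <= M.
Proof. by move=> h; apply: ge_sup => //; case: (tv_sums_has_sup mu). Qed.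

Lemma tv_norm_ge (mu : ba) A : measurable A -> `|mu A| <= tv_norm mu.
Proof.
move=> mA.
pose F (i : 'I_2) := if i == ord0 then A else ~` A.
apply: (@le_trans _ _ (\sum_(i < 2) `|mu (F i)|)).
  by rewrite !big_ord_recl big_ord0 /F/= addr0 lerDl.
apply: tv_norm_ub; exists 2%N, F; split => //.
- by move=> i; rewrite /F; case: ifP => // _; exact: measurableC.
- move=> i j _ _ [x []]; rewrite /F.
  by case: ifPn => [/eqP ->|i0]; case: ifPn => [/eqP ->|j0]//= _ _;
    apply/val_inj; move: i j i0 j0 => [[|[|//]]?] [[|[|//]]?].
- apply/seteqP; split => // x _.
  have [Ax|nAx] := pselect (A x); first by exists ord0.
  by exists (lift ord0 ord0).
Qed.

Lemma tv_normD (mu nu : ba) :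
  tv_norm (mu + nu : ba) <= tv_norm mu + tv_norm nu.
Proof.
apply: tv_norm_le => _ [n [F [mF tF UF ->]]].
apply: (@le_trans _ _ (\sum_(i < n) `|mu (F i)| + \sum_(i < n) `|nu (F i)|)).
  by rewrite -big_split/=; apply: ler_sum => i _; exact: ler_normD.
by apply: lerD; apply: tv_norm_ub; exists n, F.
Qed.

Lemma tv_normZ (a : R) (mu : ba) : tv_norm (a *: mu : ba) = `|a| * tv_norm mu.
Proof.
have le b (nu : ba) : tv_norm (b *: nu : ba) <= `|b| * tv_norm nu.
  apply: tv_norm_le => _ [n [F [mF tF UF ->]]].
  rewrite (eq_bigr (fun i => `|b| * `|nu (F i)|)) => [|i _].
    by rewrite -mulr_sumr ler_wpM2l//; apply: tv_norm_ub; exists n, F.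
  by rewrite baZ normrM.
have ge0 (nu : ba) : 0 <= tv_norm nu.
  exact: le_trans (tv_norm_ge nu measurable0).
apply/eqP; rewrite eq_le le andTb.
have [->|a0] := eqVneq a 0; first by rewrite normr0 mul0r ge0.
rewrite -ler_pdivlMl ?normr_gt0// -normfV.
by apply: le_trans (le a^-1 (a *: mu)); rewrite scalerA mulVf// scale1r lexx.
Qed.

Lemma tv_norm0_eq0 (mu : ba) : tv_norm mu = 0 -> mu = 0.
Proof.
move=> mu0; apply: ba_eq => A mA; apply/eqP.
by rewrite -normr_le0 -mu0 tv_norm_ge.
Qed.

HB.instance Definition _ :=
  Lmodule_isNormed.Build R ba tv_normD tv_normZ tv_norm0_eq0.

Definition bounded_measurable : set (T -> R) :=
  [set f : T -> R | measurable_fun [set: T] f /\ exists C : R, forall x, `|f x| <= C].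

Definition simple_integral (mu : ba) (g : T -> R) : R :=
  \sum_(y \in range g) y * mu (g @^-1` [set y]).

(* The limit of the integrals of the simple functions g as g tends to f
   uniformly on T. *)
Definition ba_integral (mu : ba) (f : T -> R) : R :=
  lim (simple_integral mu @
       within [set g : T -> R | measurable_fun [set: T] g /\ finite_set (range g)]
              (nbhs (f : {uniform T -> R}))).

Definition weak_star : Type :=
  initial_topology
    (fun mu : ba => (fun f => ba_integral mu (set_val f))
       : {ptws bounded_measurable -> R}).
HB.instance Definition _ := Topological.on weak_star.

Definition ba_of_probability_fun (mu : probability T R) : set T -> R^o :=
  fun A => if `[< measurable A >] then fine (mu A) else 0.

Lemma ba_of_probability_subproof mu : ba_of_probability_fun mu \in ba_pred.
Proof.
apply/asboolP; rewrite /ba_of_probability_fun; split.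
- move=> A B mA mB AB; rewrite !asboolT//; last exact: measurableU.
  by rewrite measureU// fineD// fin_num_measure.
- exists 1 => A mA; rewrite asboolT// ger0_norm ?fine_ge0//.
  by rewrite -lee_fin fineK ?fin_num_measure// probability_le1.
- by move=> A nA; rewrite asboolF.
Qed.

Definition ba_of_probability (mu : probability T R) : ba :=
  Ba (ba_of_probability_subproof mu).

Definition convex_hull (P : set (probability T R)) : set ba :=
  smallest (@convex_set R ba) (ba_of_probability @` P).

Definition closed_convex_hull (P : set (probability T R)) : set ba :=
  closure (convex_hull P).

Definition weak_star_closed_convex_hull (P : set (probability T R)) : set ba :=
  closure (convex_hull P : set weak_star).

Definition dTV (mu nu : ba) : R := 2^-1 * `|mu - nu|.

Definition dTV_set (S S' : set ba) : R :=
  inf [set dTV mu nu | mu in S & nu in S'].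

Definition test : set (T -> R) :=
  [set phi : T -> R | measurable_fun [set: T] phi /\ forall x, 0 <= phi x <= 1].

Local Open Scope ereal_scope.

Definition risk (phi : T -> R) (P Q : set (probability T R)) : \bar R :=
  ereal_sup [set 'E_mu[phi] | mu in P] +
  ereal_sup [set 'E_nu[fun x => (1 - phi x)%R] | nu in Q].

Definition minimax_risk (P Q : set (probability T R)) : \bar R :=
  ereal_inf [set risk phi P Q | phi in test].

End ba.

(* Main.v *)
From HB Require Import structures.
Require Import Defs.
From mathcomp Require Import all_boot all_order all_algebra finmap.
From mathcomp Require Import all_classical all_reals all_analysis.
From mathcomp Require Import measurable_realfun ring lra.

(* Let delta and delta* be the distances between the norm-closed and between
   the weak-* closed convex hulls.  Norm-closed hulls lie in weak-* closed ones,
   so delta* <= delta.  An integral inequality valid on P passes to its weak-*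
   closed convex hull, so every test has risk at least 1 - delta*.  It remains
   to find one test of risk at most 1 - delta.  Hahn-Banach separates the convex
   set co(Q) - co(P) from the open ball of radius 2 delta of ba by a linear
   functional l bounded by the norm.  Restricted to the measures with a density
   in L1(rho), for a finite measure rho with gamma << rho, l is a functional on
   L1(rho), hence integration against some phi0 with |phi0| <= 1
   (Radon-Nikodym), and (1 + phi0) / 2 is the test. *)

Set Implicit Arguments.
Unset Strict Implicit.
Unset Printing Implicit Defensive.

Import Order.TTheory GRing.Theory Num.Theory.
Import numFieldNormedType.Exports.
Import HBSimple.

Local Open Scope classical_set_scope.
Local Open Scope ring_scope.

(** * Hahn-Banach separation *)

Section sublinear.
Context (R : realType) (V : lmodType R).
Implicit Types (p : V -> R) (x y : V).

(** Homogeneity is asked as an inequality because this is what an infimum inherits directly;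
    [sublinearZ] recovers the equality. *)
Definition sublinear p : Prop :=
  (forall x y, p (x + y) <= p x + p y) /\
  (forall t x, 0 <= t -> p (t *: x) <= t * p x).

Lemma sublinearZ p t x : sublinear p -> 0 <= t -> p (t *: x) = t * p x.
Proof.
move=> [pD pZ] t0; apply/eqP; rewrite eq_le pZ//=.
move: t0; rewrite [0 <= t]le_eqVlt => /orP[/eqP<-|t0].
  have := pD 0 0; rewrite addr0 mul0r scale0r; lra.
rewrite -ler_pdivlMl//; have := pZ t^-1 (t *: x).
by rewrite scalerA mulVf ?gt_eqF// scale1r invr_ge0 ltW// => ->.
Qed.

Lemma sublinear_ge p x : sublinear p -> - p (- x) <= p x.
Proof.
move=> sp; have [pD _] := sp; have := pD x (- x).
by rewrite subrr -[X in p X](scale0r x) sublinearZ// mul0r; lra.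
Qed.

(** Serves three times: for the additivity of a minimal functional, for lower bounds of chains, and
    for the separation of a convex set from a ball. *)
Lemma sublinear_inf (S : V -> set R) :
  (forall x, S x !=set0) -> (forall x, has_lbound (S x)) ->
  (forall x y r s, S x r -> S y s -> S (x + y) (r + s)) ->
  (forall t x r, 0 <= t -> S x r -> S (t *: x) (t * r)) ->
  sublinear (fun x => inf (S x)).
Proof.
move=> S0 Slb SD SZ; split=> [x y|t x].
  rewrite -lerBlDr; apply: lb_le_inf => // r Sxr.
  rewrite lerBlDr [leRHS]addrC -lerBlDr; apply: lb_le_inf => // s Sys.
  by rewrite lerBlDr [leRHS]addrC; apply: ge_inf => //; exact: SD.
rewrite [0 <= t]le_eqVlt => /orP[/eqP<-|t0].
  rewrite mul0r; apply: ge_inf => //; have [r Sr] := S0 x.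
  by rewrite -[0 in X in _ X](mul0r r); exact: SZ.
rewrite -ler_pdivrMl//; apply: lb_le_inf => // r Sxr.
by rewrite ler_pdivrMl//; apply: ge_inf => //; apply: SZ => //; exact: ltW.
Qed.

(** Minimality makes [q] additive; additivity gives [q (- x) = - q x], which extends homogeneity to
    negative scalars. *)
Lemma minimal_sublinear_linear (q : V -> R) : sublinear q ->
  (forall p, sublinear p -> (forall x, p x <= q x) -> p = q) -> linear (q : V -> R^o).
Proof.
move=> sq qmin; have [qD _] := sq.
have qDE x y : q (x + y) = q x + q y.
  apply/eqP; rewrite eq_le qD andTb.
  (* [z |-> inf_t (q (z + t x) - t q x)] is sublinear and at most [q], hence
     equal to [q]; take [t = 1]. *)
  pose S z : set R :=
    [set r | exists2 t, 0 <= t & q (z + t *: x) - t * q x <= r].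
  have Slb z : lbound (S z) (- q (- z)).
    move=> r [t t0 tr]; apply: le_trans tr.
    by rewrite -sublinearZ// lerBrDl lerBlDr (le_trans _ (qD _ _))// addrAC subrr add0r.
  have S_q z : S z (q z) by exists 0; rewrite // scale0r mul0r addr0 subr0.
  have sS : sublinear (fun z => inf (S z)).
    apply: sublinear_inf => [z|z|z w r s [t t0 tr] [u u0 us]|t z r t0 [u u0 ur]].
    + by exists (q z).
    + by exists (- q (- z)).
    + exists (t + u); first exact: addr_ge0.
      rewrite scalerDl addrACA; have := qD (z + t *: x) (w + u *: x); lra.
    + exists (t * u); first exact: mulr_ge0.
      by rewrite -scalerA -scalerDr -mulrA sublinearZ// -mulrBr ler_wpM2l.
  have Sq z : inf (S z) <= q z by apply: ge_inf => //; exists (- q (- z)).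
  rewrite -lerBrDl -[q in X in X <= _](qmin _ sS Sq).
  apply: ge_inf; first by exists (- q (- y)).
  by exists 1; rewrite // scale1r mul1r [y + x]addrC.
have qN x : q (- x) = - q x.
  apply/eqP; rewrite -addr_eq0 -qDE addrC subrr -[X in q X](scale0r 0).
  by rewrite sublinearZ// mul0r.
move=> t x y; rewrite qDE; congr (_ + _).
have [t0|t0] := leP 0 t; first by rewrite sublinearZ.
by rewrite -[in LHS](opprK t) scaleNr qN sublinearZ ?oppr_ge0 ?ltW// mulNr opprK.
Qed.

(** Zorn's lemma yields a minimal sublinear functional below [p], and it is linear. A nonempty chain
    is bounded below by its pointwise infimum, finite because each member is at least [- p (- x)] at
    [x]. *)
Lemma hahn_banach p : sublinear p ->
  exists l : {linear V -> R^o}, forall x, l x <= p x.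
Proof.
move=> sp.
pose X := {q : V -> R | sublinear q /\ forall x, q x <= p x}.
(* The order is reversed, so that a maximal element is a minimal functional. *)
have [||||[q [sq qp]] qmin] :=
  @Zorn X (fun u v : X => `[< forall x, sval v x <= sval u x >]).
- by move=> q; exact/asboolP.
- move=> q r s /asboolP qr /asboolP rs; apply/asboolP => x.
  exact: le_trans (rs x) (qr x).
- move=> [q qP] [r rP] /asboolP/= qr /asboolP/= rq; apply/eq_exist/funext => x.
  by apply/eqP; rewrite eq_le qr rq.
- move=> A Atot.
  have [[q0 Aq0]|A0] := pselect (A !=set0); last first.
    exists (exist _ p (conj sp (fun x => lexx _))) => q Aq.
    by exfalso; apply: A0; exists q.
  pose S x : set R := [set r | exists2 q, A q & sval q x <= r].
  have S_q q x : A q -> S x (sval q x) by exists q.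
  have Slb x : has_lbound (S x).
    exists (- p (- x)) => r [q Aq qr]; apply: le_trans qr.
    have [sq qp] := svalP q.
    by rewrite (le_trans _ (sublinear_ge x sq))// lerN2.
  have sS : sublinear (fun x => inf (S x)).
    apply: sublinear_inf => // [x|x y r s [q Aq qr] [u Au us]|t x r t0 [q Aq qr]].
    + by exists (sval q0 x); exact: S_q.
    (* One of [q] and [u] lies below the other, and that one alone witnesses the bound at
       [x + y]. *)
    + have [/asboolP uq|/asboolP qu] := Atot _ _ Aq Au.
        exists u => //; have [[uD _] _] := svalP u.
        by rewrite (le_trans (uD _ _))// lerD// (le_trans (uq _)).
      exists q => //; have [[qD _] _] := svalP q.
      by rewrite (le_trans (qD _ _))// lerD// (le_trans (qu _)).
    + exists q => //; have [[_ qZ] _] := svalP q.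
      by rewrite (le_trans (qZ _ _ _))// ler_wpM2l.
  have Sp x : inf (S x) <= p x.
    apply: le_trans (_ : sval q0 x <= _); last by have [_] := svalP q0.
    by apply: ge_inf => //; exact: S_q.
  exists (exist _ (fun x => inf (S x)) (conj sS Sp)) => q Aq; apply/asboolP => x /=.
  by apply: ge_inf => //; exact: S_q.
have lq : linear (q : V -> R^o).
  apply: minimal_sublinear_linear => // r sr rq.
  have rp x : r x <= p x := le_trans (rq x) (qp x).
  by have /(_ (asboolT rq)) := qmin (exist _ r (conj sr rp)); case.
pose L := GRing.isLinear.Build _ _ _ _ (q : V -> R^o) lq.
pose l : {linear V -> R^o} := HB.pack (q : V -> R^o) L.
by exists l.
Qed.

End sublinear.

(** Hahn-Banach applied to the norm would give only the first bound on [l]; the second comes from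
    applying it to a smaller sublinear functional. *)
Lemma convex_norm_separation (R : realType) (V : normedModType R) (C : set V)
    (r : R) :
  C !=set0 ->
  (forall x y t, 0 <= t <= 1 -> C x -> C y -> C (t *: x + (1 - t) *: y)) ->
  (forall c, C c -> r <= `|c|) ->
  exists l : {linear V -> R^o},
    (forall x, l x <= `|x|) /\ (forall c, C c -> r <= l c).
Proof.
move=> [c0 Cc0] Cconv Cr.
(* The infimum of this set is sublinear, at most [`|x|], and at most [- r] at
   [- c] for [c] in [C]. *)
pose S x : set R :=
  [set s | exists t c, [/\ 0 <= t, C c & `|x + t *: c| - r * t <= s]].
have S_norm x : S x `|x| by exists 0, c0; rewrite scale0r mulr0 addr0 subr0.
have Slb x : has_lbound (S x).
  (* The triangle inequality gives [|x + t c| >= t |c| - |x| >= r t - |x|]. *)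
  exists (- `|x|) => s [t [c [t0 Cc tc]]]; apply: le_trans tc.
  have : t * r <= `|t *: c| by rewrite normrZ ger0_norm// ler_wpM2l// Cr.
  have := ler_normB (x + t *: c) x; rewrite addrAC subrr add0r; lra.
have sS : sublinear (fun x => inf (S x)).
  apply: sublinear_inf => // [x|x y s s' [t [c [t0 Cc tc]]] [u [b [u0 Cb ub]]]|].
  - by exists `|x|.
  (* The weights [t / (t + u)] below need a nonzero sum; otherwise both scalars vanish and only the
     triangle inequality is left. *)
  - have [tu0|tu0] := eqVneq (t + u) 0.
      have t_0 : t = 0 by lra.
      have u_0 : u = 0 by lra.
      move: tc ub; rewrite t_0 u_0 !scale0r !mulr0 !addr0 !subr0 => tc ub.
      exists 0, c; rewrite scale0r mulr0 addr0 subr0; split => //.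
      by rewrite (le_trans (ler_normD _ _))// lerD.
    have tu : 0 < t + u by lra.
    exists (t + u), ((t / (t + u)) *: c + (1 - t / (t + u)) *: b); split.
    + exact: ltW.
    + apply: Cconv => //; rewrite divr_ge0 ?(ltW tu)//=.
      by rewrite ler_pdivrMr// mul1r lerDl.
    + have -> : (t + u) *: ((t / (t + u)) *: c + (1 - t / (t + u)) *: b) =
          t *: c + u *: b.
        by rewrite scalerDr !scalerA; congr (_ *: _ + _ *: _); field.
      have := ler_normD (x + t *: c) (y + u *: b); rewrite addrACA; lra.
  - move=> u x s u0 [t [c [t0 Cc tc]]]; exists (u * t), c; split => //.
      exact: mulr_ge0.
    rewrite -scalerA -scalerDr normrZ ger0_norm// mulrCA -mulrBr.
    by rewrite ler_wpM2l.
have [l lS] := hahn_banach sS.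
exists l; split => [x|c Cc].
  by rewrite (le_trans (lS _))//; exact: ge_inf.
have : l (- c) <= - r.
  rewrite (le_trans (lS _))//; apply: ge_inf => //.
  by exists 1, c; split; rewrite // scale1r addNr normr0 mulr1 sub0r.
by rewrite raddfN lerN2.
Qed.

(** * Integration against finitely additive set functions *)

Section integral.
Context d (T : measurableType d) (R : realType).
Implicit Types (mu nu : ba T R) (f g h : T -> R).

Lemma ba_preimage_seq (X : choiceType) mu (k : T -> X) (s : seq X) :
  (forall x, measurable (k @^-1` [set x])) -> uniq s ->
  mu (k @^-1` [set` s]) = \sum_(x <- s) mu (k @^-1` [set x]).
Proof.
move=> mk; have [muD _ _] := baP mu.
elim: s => [|x s IH] /=; first by rewrite big_nil set_nil preimage_set0 ba_set0.
move=> /andP[xs us]; rewrite big_cons -IH//.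
have -> : [set` x :: s] = [set x] `|` [set` s].
  apply/seteqP; split => y /=; rewrite in_cons.
    by move=> /orP[/eqP|]; [left|right].
  by move=> [->|->]; rewrite ?eqxx// orbT.
rewrite preimage_setU muD//; last first.
  by apply/seteqP; split => // t [/= ->]; rewrite (negbTE xs).
rewrite (_ : k @^-1` [set` s] = \big[setU/set0]_(y <- s) k @^-1` [set y]).
  exact: bigsetU_measurable.
rewrite -bigcup_seq; apply/seteqP; split => t /=; first by exists (k t).
by move=> [y ys /= ->].
Qed.

(** Computes an integral along a partition finer than that of the integrand, so that two simple
    functions can be integrated over common fibres. *)
Lemma simple_integral_comp (X : choiceType) mu (k : T -> X) (G : X -> R) :
  finite_set (range k) -> (forall x, measurable (k @^-1` [set x])) ->
  simple_integral mu (G \o k) =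
  \sum_(x <- fset_set (range k)) G x * mu (k @^-1` [set x]).
Proof.
move=> fk mk; rewrite /simple_integral -(image_comp k G).
rewrite fsbig_finite/=; last exact: finite_image.
rewrite fset_set_image// (partition_big_imfset _ G)/=.
apply: eq_big_seq => y _.
rewrite (eq_bigr (fun x => y * mu (k @^-1` [set x]))); last first.
  by move=> x /eqP ->.
rewrite -mulr_sumr -big_filter -ba_preimage_seq//; last first.
  by rewrite filter_uniq// fset_uniq.
congr (_ * mu _); apply/seteqP; split => t /=.
  by move=> <-; rewrite mem_filter eqxx in_fset_set//= inE; exists t.
by rewrite mem_filter => /andP[/eqP].
Qed.

(** The fibres of [k] form one of the partitions in the supremum that defines the total
    variation. *)
Lemma sum_norm_preimage_le (X : choiceType) mu (k : T -> X) :
  finite_set (range k) -> (forall x, measurable (k @^-1` [set x])) ->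
  \sum_(x <- fset_set (range k)) `|mu (k @^-1` [set x])| <= `|mu|.
Proof.
move=> fk mk; apply: tv_norm_ub.
exists (size (fset_set (range k))),
  (fun i => k @^-1` [set tnth (in_tuple (fset_set (range k))) i]).
split => //.
- move=> i j _ _ [t [/= -> /eqP]].
  by rewrite !(tnth_nth (k t)) nth_uniq ?fset_uniq// => /eqP/val_inj.
- apply/seteqP; split => // t _.
  have : k t \in in_tuple (fset_set (range k)).
    by rewrite /= in_fset_set// inE; exists t.
  by move=> /tnthP[i]; exists i.
- by rewrite big_tnth.
Qed.

Definition simple_function : set (T -> R) :=
  [set g | measurable_fun [set: T] g /\ finite_set (range g)].

Lemma measurable_preimage1 g x : measurable_fun [set: T] g ->
  measurable (g @^-1` [set x]).
Proof. by move=> mg; rewrite -[_ @^-1` _]setTI; exact: mg. Qed.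

(** Both functions are constant on the fibres of the pair [k], so each fibre contributes at most [e]
    times the absolute value of its [mu]. This Lipschitz bound makes the limit in [ba_integral]
    exist. *)
Lemma simple_integral_dist mu g h e : 0 <= e ->
  simple_function g -> simple_function h -> (forall x, `|g x - h x| <= e) ->
  `|simple_integral mu g - simple_integral mu h| <= e * `|mu|.
Proof.
move=> e0 [mg fg] [mh fh] gh.
pose k x := (g x, h x).
have fk : finite_set (range k).
  apply: (sub_finite_set _ (finite_setX fg fh)) => _ [x _ <-] /=.
  by split; exists x.
have mk p : measurable (k @^-1` [set p]).
  rewrite (_ : _ @^-1` _ = g @^-1` [set p.1] `&` h @^-1` [set p.2]).
    by apply: measurableI; exact: measurable_preimage1.
  by apply/seteqP; split => x /=; rewrite /k; case: p => a b /= -[-> ->].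
rewrite (_ : g = fst \o k)// (_ : h = snd \o k)// !simple_integral_comp//.
rewrite -sumrB (le_trans (ler_norm_sum _ _ _))//.
apply: le_trans (ler_wpM2l e0 (sum_norm_preimage_le mu fk mk)).
rewrite mulr_sumr big_seq [leRHS]big_seq; apply: ler_sum => p.
rewrite in_fset_set// inE => -[x _ <-].
by rewrite -mulrBl normrM ler_wpM2r//; exact: gh.
Qed.

Lemma simple_integralD mu nu a g : simple_function g ->
  simple_integral (a *: mu + nu) g =
  a * simple_integral mu g + simple_integral nu g.
Proof.
move=> [mg fg].
rewrite /simple_integral !fsbig_finite//= mulr_sumr -big_split/=.
by apply: eq_bigr => y _; rewrite mulrDr mulrCA.
Qed.

Lemma simple_approximation f e : bounded_measurable f -> 0 < e ->
  exists2 g, simple_function g & forall x, `|f x - g x| <= e.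
Proof.
move=> [mf [C fC]] e0.
have C0 x : 0 <= (f x + C) / e.
  by rewrite divr_ge0 ?(ltW e0)//; have := fC x; rewrite ler_norml => /andP[]; lra.
(* The shift by [C] makes [f] nonnegative, so that truncation rounds it down to a multiple of [e];
   finitely many multiples occur. *)
pose g x : R := e * (Num.trunc ((f x + C) / e))%:R - C.
exists g; last first.
  move=> x; rewrite /g; have /andP[] := truncn_itv (C0 x).
  set n := Num.trunc _; rewrite ler_pdivlMr// ltr_pdivrMr// -natr1 mulrDl mul1r => h1 h2.
  by rewrite ler_norml; apply/andP; split; lra.
split.
  apply: measurable_funB => //; apply: measurable_funM => //.
  apply: (@measurableT_comp _ _ _ _ _ _ (fun y : R => (Num.trunc y)%:R : R)).
    apply: nondecreasing_measurable => // x y xy.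
    by rewrite ler_nat le_truncn.
  by apply: measurable_funM => //; exact: measurable_funD.
apply: (sub_finite_set _ (finite_image (fun n : nat => e * n%:R - C)
  (finite_II (Num.trunc ((C + C) / e)).+1))) => _ [x _ <-].
exists (Num.trunc ((f x + C) / e)) => //=.
rewrite ltnS le_truncn// ler_pM2r ?invr_gt0//.
by have := fC x; rewrite ler_norml => /andP[]; lra.
Qed.

Notation simple_nbhs f :=
  (within simple_function (nbhs (f : {uniform T -> R}))).

Lemma simple_nbhsP f (P : set (T -> R)) : simple_nbhs f P <->
  exists2 e, 0 < e &
    forall g, simple_function g -> (forall x, `|f x - g x| < e) -> P g.
Proof.
split.
  move=> /uniform_nbhs[E [+ EP]]; rewrite -entourage_ballE => -[e /= e0 eE].
  by exists e => // g sg fg; apply: EP => // x _; apply: eE; exact: fg.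
move=> [e e0 eP]; apply/uniform_nbhs.
exists [set xy | ball xy.1 e xy.2]; split.
  by rewrite -entourage_ballE; exists e.
by move=> g fg sg; apply: eP => // x; exact: fg.
Qed.

Lemma simple_nbhs_proper f : bounded_measurable f ->
  ProperFilter (simple_nbhs f).
Proof.
move=> bf; apply: Build_ProperFilter_ex => P /simple_nbhsP[e e0 eP].
have e20 : 0 < e / 2 by rewrite divr_gt0.
have [g sg fg] := simple_approximation bf e20.
exists g; apply: eP => // x; apply: le_lt_trans (fg x) _; lra.
Qed.

Lemma ba_integral_cvg mu f : bounded_measurable f ->
  cvg (simple_integral mu @ simple_nbhs f).
Proof.
move=> bf; have PF := simple_nbhs_proper bf.
apply/cauchy_cvgP/cauchyP => e e0.
have M0 : 0 < `|mu| + 1 by rewrite ltr_wpDl.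
(* Two functions within [a] of [f] are within [2 a] of each other, and [2 a |mu| < e]. The added 1
   covers [mu = 0]. *)
pose a := e / (`|mu| + 1) / 3.
have a0 : 0 < a by rewrite !divr_gt0.
have [g sg fg] := simple_approximation bf a0.
exists (simple_integral mu g); apply/simple_nbhsP; exists a => // h sh fh /=.
rewrite /ball/=; apply: (@le_lt_trans _ _ (a * 2 * `|mu|)).
  apply: simple_integral_dist => //; first by rewrite mulr_ge0// ltW.
  move=> x; rewrite -(subrKA (f x)) (le_trans (ler_normD _ _))// distrC.
  by have := fg x; have := fh x; lra.
have -> : a * 2 * `|mu| = e * (2 / 3 * (`|mu| / (`|mu| + 1))).
  by rewrite /a; field; rewrite gt_eqF.
rewrite gtr_pMr//; have : `|mu| / (`|mu| + 1) <= 1.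
  by rewrite ler_pdivrMr// mul1r lerDl.
lra.
Qed.

(** The limit form of [simple_integral_dist]. The properties of [ba_integral] below rest on it, with
    a simple function in place of [f]. *)
Lemma ba_integral_simple_dist mu f g e : bounded_measurable f ->
  simple_function g -> 0 <= e -> (forall x, `|f x - g x| <= e) ->
  `|ba_integral mu f - simple_integral mu g| <= e * `|mu|.
Proof.
move=> bf sg e0 fg; have PF := simple_nbhs_proper bf.
have cv : simple_integral mu @ simple_nbhs f --> ba_integral mu f.
  exact: ba_integral_cvg.
apply/ler_addgt0Pr => r r0.
have M0 : 0 < `|mu| + 1 by rewrite ltr_wpDl.
pose a := r / (`|mu| + 1).
have a0 : 0 < a by rewrite divr_gt0.
have near_h : simple_nbhs f
    [set h | `|simple_integral mu h - simple_integral mu g| <= (e + a) * `|mu|].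
  apply/simple_nbhsP; exists a => // h sh fh /=.
  apply: simple_integral_dist => //; first by rewrite addr_ge0 ?(ltW a0).
  move=> x; rewrite -(subrKA (f x)) (le_trans (ler_normD _ _))// distrC.
  by have := fg x; have := fh x; lra.
move/cvgrPdist_lt : cv => /(_ a a0) near_lim.
have [h [h1 h2]] := filter_ex (filterI near_h near_lim).
have -> : e * `|mu| + r = a + (e + a) * `|mu|.
  by rewrite /a; field; rewrite gt_eqF.
rewrite -(subrKA (simple_integral mu h)) (le_trans (ler_normD _ _))// lerD//.
exact: ltW.
Qed.

Lemma ba_integralD mu nu a f : bounded_measurable f ->
  ba_integral (a *: mu + nu) f = a * ba_integral mu f + ba_integral nu f.
Proof.
move=> bf; apply/eqP; rewrite -subr_eq0 -normr_le0; apply/ler_addgt0Pr => r r0.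
(* Collects the norms from the three approximation errors, whose sum is then at most
   [e * K <= r]. *)
pose K := `|a *: mu + nu| + `|a| * `|mu| + `|nu|.
have K0 : 0 < K + 1 by rewrite ltr_wpDl// !addr_ge0// mulr_ge0.
pose e := r / (K + 1).
have e0 : 0 < e by rewrite divr_gt0.
have [g sg fg] := simple_approximation bf e0.
have dist rho := ba_integral_simple_dist rho bf sg (ltW e0) fg.
rewrite add0r (_ : _ - _ = (ba_integral (a *: mu + nu) f -
      simple_integral (a *: mu + nu) g) -
    a * (ba_integral mu f - simple_integral mu g) -
    (ba_integral nu f - simple_integral nu g)); last first.
  by rewrite simple_integralD//; ring.
rewrite (le_trans (ler_normB _ _))// (@le_trans _ _ (e * K))//; last first.
  rewrite /e mulrAC -mulrA ger_pMr// ler_pdivrMr// mul1r; lra.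
rewrite /K 2!(mulrDr e) lerD// (le_trans (ler_normB _ _))// lerD//.
by rewrite normrM mulrCA ler_wpM2l.
Qed.

Lemma ba_integral_le mu f e : bounded_measurable f -> 0 <= e ->
  (forall x, `|f x| <= e) -> `|ba_integral mu f| <= e * `|mu|.
Proof.
move=> bf e0 fe.
have s0 : simple_function (cst 0).
  split; first exact: measurable_cst.
  by apply: (sub_finite_set _ (finite_set1 (0 : R))) => _ [x _ <-].
have I0 : simple_integral mu (cst 0) = 0.
  by rewrite /simple_integral fsbig1// => _ [x _ <-]; rewrite mul0r.
rewrite -[X in `|X|]subr0 -I0; apply: ba_integral_simple_dist => // x.
by rewrite subr0.
Qed.

Lemma simple_functionE g x : finite_set (range g) ->
  g x = \sum_(y <- fset_set (range g)) y * \1_(g @^-1` [set y]) x.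
Proof.
move=> fg; rewrite (bigD1_seq (g x)) ?fset_uniq//=; last first.
  by rewrite in_fset_set// inE; exists x.
rewrite indicE mem_set// mulr1 big1 ?addr0// => y yx.
by rewrite indicE memNset ?mulr0//= => /esym/eqP; exact/negP.
Qed.

Lemma simple_integral_probability (mu : probability T R) g :
  simple_function g ->
  simple_integral (ba_of_probability mu) g = \int[mu]_x g x.
Proof.
move=> [mg fg].
rewrite /simple_integral fsbig_finite// /Rintegral.
have mp y : measurable (g @^-1` [set y]) by exact: measurable_preimage1.
under eq_integral do rewrite (simple_functionE _ fg) -sumEFin.
have int_indic y : mu.-integrable [set: T] (EFin \o \1_(g @^-1` [set y])).
  exact: integrable_indic.
rewrite integral_sum//=; last first.
  move=> y; under eq_fun do rewrite EFinM.
  by apply: integrableZl => //; exact: int_indic.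
rewrite (eq_bigr (fun y => (y * ba_of_probability mu (g @^-1` [set y]))%:E)).
  by rewrite sumEFin.
move=> y _; under eq_integral do rewrite EFinM.
rewrite integralZl//; last exact: int_indic.
rewrite integral_indic// setIT EFinM.
by rewrite /= /ba_of_probability_fun asboolT// fineK// fin_num_measure.
Qed.

Lemma integrable_bounded (mu : {finite_measure set T -> \bar R}) f :
  bounded_measurable f -> mu.-integrable [set: T] (EFin \o f).
Proof.
move=> [mf [C fC]]; apply: measurable_bounded_integrable => //.
  by rewrite ltey_eq fin_num_measure.
exists C; split; first exact: num_real.
by move=> x Cx y _; exact: le_trans (fC y) (ltW Cx).
Qed.

Lemma simple_function_bounded g : simple_function g -> bounded_measurable g.
Proof.
move=> [mg fg]; split => //.
exists (\sum_(y <- fset_set (range g)) `|y|) => x.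
rewrite (bigD1_seq (g x)) ?fset_uniq//=; last first.
  by rewrite in_fset_set// inE; exists x.
by rewrite lerDl sumr_ge0.
Qed.

(** Both integrals agree on simple functions, and each changes little under a uniformly small change
    of the integrand. *)
Lemma ba_integral_probability (mu : probability T R) f :
  bounded_measurable f ->
  ba_integral (ba_of_probability mu) f = \int[mu]_x f x.
Proof.
move=> bf; apply/eqP; rewrite -subr_eq0 -normr_le0; apply/ler_addgt0Pr => r r0.
set m := ba_of_probability mu; have K0 : 0 < `|m| + 1 by rewrite ltr_wpDl.
pose e := r / (`|m| + 1).
have e0 : 0 < e by rewrite divr_gt0.
have [g sg fg] := simple_approximation bf e0.
have bg := simple_function_bounded sg.
have h1 := ba_integral_simple_dist m bf sg (ltW e0) fg.
rewrite simple_integral_probability// in h1.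
have h2 : `|\int[mu]_x g x - \int[mu]_x f x| <= e.
  rewrite -RintegralB//; [|exact: integrable_bounded..].
  have bgf : bounded_measurable (g \- f).
    split; first by apply: measurable_funB; [case: bg|case: bf].
    by exists e => x; rewrite distrC.
  rewrite (le_trans (le_normr_Rintegral _ (integrable_bounded _ bgf)))//.
  have -> : e = \int[mu]_x e.
    rewrite Rintegral_cst//; have /(congr1 fine) /= -> := probability_setT mu.
    by rewrite mulr1.
  apply: le_Rintegral => //.
  - by have /integrable_norm := integrable_bounded mu bgf.
  - by apply: integrable_bounded; split; [exact: measurable_cst|exists `|e|].
  - by move=> x _ /=; rewrite distrC.
rewrite add0r -(subrKA (\int[mu]_x g x)) (le_trans (ler_normD _ _))//.
rewrite (le_trans (lerD h1 h2))// -[X in _ + X]mulr1 -mulrDr /e divfK ?gt_eqF//.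
Qed.

End integral.

(** * The dual of L1 of a finite measure *)

Section L1_dual.
Context d (T : measurableType d) (R : realType).
Variable gamma : {finite_measure set T -> \bar R}.
Implicit Types (f g h : T -> R) (L : (T -> R) -> R).

Notation L1 g := (gamma.-integrable [set: T] (EFin \o g)).

(** No quotient by null functions is formed: [L] acts on functions, and linearity together with
    [L1_bounded] makes it blind to null sets. *)
Definition L1_linear L := forall a f g, L1 f -> L1 g ->
  L (fun x => a * f x + g x) = a * L f + L g.

Definition L1_bounded M L := forall g, L1 g ->
  `|L g| <= M * \int[gamma]_x `|g x|.

Lemma L1_indic A : measurable A -> L1 (\1_A : T -> R).
Proof. exact: integrable_indic. Qed.

Lemma L1Z a g : L1 g -> L1 (fun x => a * g x).
Proof.
move=> ig; rewrite /comp; under eq_fun do rewrite EFinM.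
exact: integrableZl.
Qed.

Lemma L1D f g : L1 f -> L1 g -> L1 (fun x => f x + g x).
Proof.
move=> fi gi; rewrite /comp; under eq_fun do rewrite EFinD.
exact: integrableD.
Qed.

Lemma L1_sum (I : Type) (r : seq I) (c : I -> R) (u : I -> T -> R) :
  (forall i, L1 (u i)) -> L1 (fun x => \sum_(i <- r) c i * u i x).
Proof.
move=> iu; elim: r => [|i r IH].
  by under eq_fun do rewrite big_nil; exact: finite_measure_integrable_cst.
by under eq_fun do rewrite big_cons; apply: L1D => //; exact: L1Z.
Qed.

Lemma L1_linear0 L : L1_linear L -> L (fun=> 0) = 0.
Proof.
move=> Llin; have i0 : L1 (fun=> 0 : R) by exact: finite_measure_integrable_cst.
have := Llin (- 1) _ _ i0 i0; under eq_fun do rewrite mulr0 addr0.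
by rewrite mulN1r addNr.
Qed.

Lemma L1_linear_sum L (I : Type) (r : seq I) (c : I -> R) (u : I -> T -> R) :
  L1_linear L -> (forall i, L1 (u i)) ->
  L (fun x => \sum_(i <- r) c i * u i x) = \sum_(i <- r) c i * L (u i).
Proof.
move=> Llin iu; elim: r => [|i r IH].
  by under eq_fun do rewrite big_nil; rewrite L1_linear0// big_nil.
under eq_fun do rewrite big_cons.
by rewrite Llin// ?IH ?big_cons//; exact: L1_sum.
Qed.

(** Vanishing on indicators gives vanishing on simple functions, which are dense in L1; the bound
    carries this to the limit. *)
Lemma L1_functional_eq0 M L : L1_linear L -> L1_bounded M L ->
  (forall A, measurable A -> L \1_A = 0) -> forall g, L1 g -> L g = 0.
Proof.
move=> Llin Lbd L0 g ig.
have Ls s : simple_function s -> L s = 0.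
  move=> [ms fs].
  rewrite (_ : s = fun x => \sum_(y <- fset_set (range s))
      y * \1_(s @^-1` [set y]) x); last first.
    by apply/funext => x; exact: simple_functionE.
  have ms1 y : measurable (s @^-1` [set y]) by exact: measurable_preimage1.
  rewrite (@L1_linear_sum L _ _ id (fun y => \1_(s @^-1` [set y])))//; last first.
    by move=> y; exact: L1_indic.
  by rewrite big1// => y _; rewrite L0// mulr0.
have [s [si _ sg]] := approximation_sfun_integrable measurableT ig.
have bd n : `|L g| <= M * \int[gamma]_x `|g x - s n x|.
  have Ls_n : L (s n) = 0.
    by apply: Ls; split; [exact: measurable_funP|exact: fimfunP].
  have -> : L g = L (fun x => (- 1) * s n x + g x).
    by rewrite Llin// Ls_n mulr0 add0r.
  have -> : \int[gamma]_x `|g x - s n x| = \int[gamma]_x `|(- 1) * s n x + g x|.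
    by apply: eq_Rintegral => x _; rewrite mulN1r addrC.
  by apply: Lbd; apply: L1D => //; exact: L1Z.
have lim0 : M * \int[gamma]_x `|g x - s n x| @[n --> \oo] --> M * 0.
  apply: cvgM; first exact: cvg_cst.
  by move/fine_cvg : sg.
apply/eqP; rewrite -normr_le0 -(mulr0 M).
by apply: (cvgr_to_ge lim0); exact: nearW.
Qed.

Lemma L1_min1 h : L1 h -> L1 (fun x => Num.min (h x) 1).
Proof.
move=> ih; apply: (le_integrable measurableT _ _ ih).
  have mh : measurable_fun [set: T] h.
    by apply/measurable_EFinP; exact: measurable_int ih.
  by apply/measurable_EFinP; exact: measurable_minr.
move=> x _ /=; rewrite lee_fin; have [//|h1] := leP (h x) 1.
by rewrite normr1 (le_trans (ltW h1))// ler_norm.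
Qed.

(** The excess of [h] over its truncation lives on the set where [h > 1], and the hypothesis makes
    its integral there at most 0. A density can thus be made at most 1 everywhere without changing
    its integrals. *)
Lemma Rintegral_truncated h : L1 h ->
  (forall A, measurable A -> \int[gamma]_(x in A) h x <= fine (gamma A)) ->
  forall A, measurable A ->
    \int[gamma]_(x in A) Num.min (h x) 1 = \int[gamma]_(x in A) h x.
Proof.
move=> ih hle A mA.
pose k x := h x - Num.min (h x) 1.
pose E := [set x | 1 < h x].
have mh : measurable_fun [set: T] h.
  by apply/measurable_EFinP; exact: measurable_int ih.
have mE : measurable E.
  rewrite (_ : E = h @^-1` `]1, +oo[%classic); last first.
    by apply/seteqP; split => x /=; rewrite in_itv/= andbT.
  by rewrite -[_ @^-1` _]setTI; apply: mh.
have sub1 B : measurable B -> gamma.-integrable B (EFin \o h).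
  by move=> mB; exact: integrableS ih.
have imin B : measurable B ->
    gamma.-integrable B (EFin \o (fun x => Num.min (h x) 1)).
  by move=> mB; apply: (integrableS measurableT) => //; exact: L1_min1.
apply/eqP; rewrite eq_sym -subr_eq0 -RintegralB//; [|exact: sub1|exact: imin].
rewrite eq_le Rintegral_ge0 ?andbT; last first.
  by move=> x _; rewrite subr_ge0 ge_min lexx.
have -> : \int[gamma]_(x in A) (h x - Num.min (h x) 1) =
    \int[gamma]_(x in A `&` E) (h x - 1).
  rewrite Rintegral_mkcondr; apply: eq_Rintegral => x _.
  rewrite patchE; have [h1|h1] := leP (h x) 1.
    by rewrite memNset ?subrr// /E/= ltNge h1.
  by rewrite mem_set.
have mAE : measurable (A `&` E) by exact: measurableI.
rewrite RintegralB//; [|exact: sub1|exact: finite_measure_integrable_cst].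
by rewrite Rintegral_cst// mul1r subr_le0; exact: hle.
Qed.

Lemma L1_linear_Rintegral : L1_linear (fun g => \int[gamma]_x g x).
Proof.
move=> a f g fi gi; rewrite RintegralD ?RintegralZl//; exact: L1Z.
Qed.

Lemma Rintegral_indic A : measurable A ->
  \int[gamma]_x (\1_A x : R) = fine (gamma A).
Proof. by move=> mA; rewrite /Rintegral integral_indic// setIT. Qed.

Lemma L1_bounded_indic L A : L1_bounded 1 L -> measurable A ->
  `|L \1_A| <= fine (gamma A).
Proof.
move=> Lbd mA; rewrite (le_trans (Lbd _ (L1_indic mA)))// mul1r.
rewrite -Rintegral_indic// le_eqVlt; apply/orP; left; apply/eqP.
by apply: eq_Rintegral => x _; rewrite ger0_norm.
Qed.

(** The difference on the left is [L] at the indicator [g] of the union of the remaining sets,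
    bounded by the integral of [g]. Countable additivity of [L] on sets thus follows from that of
    [gamma]. *)
Lemma L1_functional_tail L (F : (set T)^nat) n :
  L1_linear L -> L1_bounded 1 L -> (forall i, measurable (F i)) ->
  trivIset [set: nat] F ->
  `|L \1_(\bigcup_i F i) - \sum_(0 <= i < n) L \1_(F i)| <=
  fine (gamma (\bigcup_i F i)) - \sum_(0 <= i < n) fine (gamma (F i)).
Proof.
move=> Llin Lbd mF tF; set U := \bigcup_i F i.
have mU : measurable U by exact: bigcup_measurable.
pose g x : R := - 1 * \sum_(0 <= i < n) 1 * \1_(F i) x + \1_U x.
have isum : L1 (fun x => \sum_(0 <= i < n) 1 * \1_(F i) x : R).
  by apply: L1_sum => i; exact: L1_indic.
have ig : L1 g by apply: L1D; [exact: L1Z|exact: L1_indic].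
(* Stated for any [K] because it is used both for [L] and for the integral. *)
have gE (K : (T -> R) -> R) : L1_linear K ->
    K g = K \1_U - \sum_(0 <= i < n) K \1_(F i).
  move=> Klin; rewrite /g Klin//; last exact: L1_indic.
  rewrite (@L1_linear_sum K _ _ (fun=> 1) (fun i => \1_(F i)))//; last first.
    by move=> i; exact: L1_indic.
  by rewrite mulN1r addrC; congr (_ - _); apply: eq_bigr => i _; rewrite mul1r.
have g0 x : 0 <= g x.
  rewrite /g mulN1r addrC subr_ge0.
  have [[j /= jn Fjx]|nF] := pselect (exists2 j, (j < n)%N & F j x).
    rewrite (bigD1_seq j) ?mem_index_iota ?iota_uniq//= mul1r big1 ?addr0.
      by rewrite !indicE !mem_set//; exists j.
    move=> i ij; rewrite mul1r indicE memNset// => Fix.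
    by move/eqP: ij; apply; apply: (tF i j) => //; exists x.
  rewrite big_nat big1// => i ni; rewrite mul1r indicE memNset// => Fix.
  by apply: nF; exists i.
rewrite -gE// (le_trans (Lbd _ ig))// mul1r.
rewrite (_ : \int[gamma]_x `|g x| = \int[gamma]_x g x); last first.
  by apply: eq_Rintegral => x _; rewrite ger0_norm.
rewrite (gE _ L1_linear_Rintegral) Rintegral_indic//.
by under eq_bigr do rewrite Rintegral_indic//.
Qed.

Lemma L1_functional_charge L : L1_linear L -> L1_bounded 1 L ->
  exists nu : {charge set T -> \bar R},
    forall A, measurable A -> nu A = (L \1_A)%:E.
Proof.
move=> Llin Lbd.
pose lam (A : set T) : \bar R := (L \1_A)%:E.
have lam0 : lam set0 = 0%E.
  by rewrite /lam indic0; congr EFin; exact: L1_linear0.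
have lamfin A : measurable A -> lam A \is a fin_num by [].
have lamadd : semi_sigma_additive lam.
  move=> F mF tF mUF.
  have /fine_cvg gF : (fun n => \sum_(0 <= i < n) gamma (F i))%E @ \oo -->
      (fine (gamma (\bigcup_n F n)))%:E.
    by rewrite fineK ?fin_num_measure//; exact: measure_semi_sigma_additive.
  rewrite /lam; under eq_fun do rewrite sumEFin.
  apply: cvg_EFin; first exact: nearW.
  apply/cvgrPdist_le => e e0; move/cvgrPdist_le : gF => /(_ e e0).
  apply: filterS => n /= gn.
  rewrite (le_trans (L1_functional_tail n Llin Lbd mF tF))//.
  rewrite (le_trans (ler_norm _))// sum_fine// => i _.
  by rewrite fin_num_measure.
pose C := isCharge.Build d T R lam lam0 lamfin lamadd.
pose nu : {charge set T -> \bar R} := HB.pack lam C.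
by exists nu.
Qed.

(** The Radon-Nikodym density of the charge given by [L] on indicators is bounded by 1 only almost
    everywhere; clipping it yields a bound at every point. *)
Lemma L1_dual L : L1_linear L -> L1_bounded 1 L ->
  exists phi : T -> R,
    [/\ measurable_fun [set: T] phi, (forall x, `|phi x| <= 1) &
    forall g, L1 g -> L g = \int[gamma]_x (phi x * g x)].
Proof.
move=> Llin Lbd.
have [nu nuE] := L1_functional_charge Llin Lbd.
have nu_gamma : nu `<< gamma.
  apply/null_content_dominatesP => A mA A0; rewrite nuE//; congr EFin.
  apply/eqP; rewrite -normr_le0 (le_trans (L1_bounded_indic Lbd mA))//.
  by move: A0 => /= ->.
pose h x := fine (Radon_Nikodym nu gamma x).
have hE x : (h x)%:E = Radon_Nikodym nu gamma x.
  by rewrite /h fineK// Radon_Nikodym_fin_num.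
have ih : L1 h.
  apply: eq_integrable (Radon_Nikodym_integrable nu_gamma) => //.
  by move=> x _; rewrite /= hE.
have Lh A : measurable A -> \int[gamma]_(x in A) h x = L \1_A.
  move=> mA; rewrite /Rintegral; under eq_integral do rewrite hE.
  by rewrite -Radon_Nikodym_integral// nuE.
have Lle A : measurable A -> `|L \1_A| <= fine (gamma A).
  exact: L1_bounded_indic.
pose h1 x := Num.min (h x) 1.
have ih1 : L1 h1 by exact: L1_min1.
have Lh1 A : measurable A -> \int[gamma]_(x in A) h1 x = L \1_A.
  move=> mA; rewrite (Rintegral_truncated ih)// ?Lh// => B mB.
  by rewrite Lh// (le_trans (ler_norm _))// Lle.
pose k x := - 1 * h1 x.
have ik : L1 k by exact: L1Z.
have Lk A : measurable A -> \int[gamma]_(x in A) k x = - L \1_A.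
  by move=> mA; rewrite RintegralZl ?Lh1 ?mulN1r//; exact: integrableS ih1.
(* Clipping the negative of [h1] from above bounds [phi] from below, so that [phi] is [h] clipped to
   [-1, 1]. *)
pose phi x := - 1 * Num.min (k x) 1.
have iphi : L1 phi by apply: L1Z; exact: L1_min1.
have Lphi A : measurable A -> \int[gamma]_(x in A) phi x = L \1_A.
  move=> mA; rewrite RintegralZl//; last first.
    by apply: integrableS (L1_min1 ik).
  rewrite (Rintegral_truncated ik)// ?Lk ?mulN1r ?opprK// => B mB.
  by rewrite Lk// (le_trans (ler_norm _))// normrN Lle.
have mphi : measurable_fun [set: T] phi.
  by apply/measurable_EFinP; exact: measurable_int iphi.
have phi1 x : `|phi x| <= 1.
  rewrite /phi normrM normrN1 mul1r ler_norml /k mulN1r /h1.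
  rewrite ge_min lexx orbT andbT le_min lerN2 ge_min lexx orbT/=; lra.
have iphiM g : L1 g -> L1 (fun x => phi x * g x).
  move=> ig; apply: (le_integrable measurableT _ _ ig).
    apply/measurable_EFinP; apply: measurable_funM => //.
    by apply/measurable_EFinP; exact: measurable_int ig.
  by move=> x _ /=; rewrite lee_fin normrM ler_piMl.
exists phi; split => // g ig.
(* Each of the two terms has bound 1, whence the constant 2. *)
pose D f := L f - \int[gamma]_x (phi x * f x).
suff : D g = 0 by rewrite /D => /eqP; rewrite subr_eq0 => /eqP.
apply: (@L1_functional_eq0 2 D) => //.
- move=> a f u fi ui; rewrite /D Llin//.
  rewrite (_ : \int[gamma]_x (phi x * (a * f x + u x)) =
    \int[gamma]_x (a * (phi x * f x) + phi x * u x)).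
    by rewrite L1_linear_Rintegral; [ring|exact: iphiM..].
  by apply: eq_Rintegral => x _; ring.
- move=> f fi; rewrite /D (le_trans (ler_normB _ _))//.
  rewrite mulrDl lerD//; first exact: Lbd.
  rewrite mul1r (le_trans (le_normr_Rintegral _ (iphiM _ fi)))//.
  apply: le_Rintegral => //.
  + by have /integrable_norm := iphiM _ fi.
  + exact: integrable_norm.
  + by move=> x _; rewrite normrM ler_piMl.
- move=> A mA; rewrite /D -Lphi// Rintegral_mkcond.
  apply/eqP; rewrite subr_eq0; apply/eqP; apply: eq_Rintegral => x _.
  by rewrite patchE indicE; case: ifP; rewrite ?mulr1 ?mulr0.
Qed.

End L1_dual.

(** * Tests and convex hulls *)

Section ba_density.
Context d (T : measurableType d) (R : realType).
Variable gamma : {finite_measure set T -> \bar R}.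
Implicit Types f g : T -> R.

Notation L1 g := (gamma.-integrable [set: T] (EFin \o g)).

Lemma Rintegral_subset_le g A : L1 g -> measurable A ->
  `|\int[gamma]_(x in A) g x| <= \int[gamma]_x `|g x|.
Proof.
move=> ig mA; rewrite Rintegral_mkcond.
have igA : L1 (g \_ A).
  rewrite -restrict_EFin; apply/(integrable_mkcond _ mA).
  exact: integrableS ig.
rewrite (le_trans (le_normr_Rintegral _ igA))//; apply: le_Rintegral => //.
- exact: integrable_norm.
- exact: integrable_norm.
- by move=> x _; rewrite patchE; case: ifP => // _; rewrite normr0.
Qed.

Definition density_fun g : set T -> R^o :=
  fun A => if `[< measurable A >] then \int[gamma]_(x in A) g x else 0.

Lemma density_fun_ba g : L1 g -> density_fun g \in @ba_pred d T R.
Proof.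
move=> ig; apply/asboolP; rewrite /density_fun; split.
- move=> A B mA mB AB; rewrite !asboolT//; last exact: measurableU.
  rewrite Rintegral_setU//; last by apply/disj_setPS; rewrite AB.
  by apply: integrableS ig => //; exact: measurableU.
- exists (\int[gamma]_x `|g x|) => A mA; rewrite asboolT//.
  exact: Rintegral_subset_le.
- by move=> A nA; rewrite asboolF.
Qed.

(* This is [0] when [g] is not integrable. *)
Definition ba_density g : ba T R := insubd (0 : ba T R) (density_fun g).

Lemma ba_densityE g A : L1 g -> measurable A ->
  ba_density g A = \int[gamma]_(x in A) g x.
Proof.
move=> ig mA; rewrite /ba_density -[LHS]/(val _ A) insubdK ?density_fun_ba//.
by rewrite /density_fun asboolT.
Qed.

Lemma ba_densityD a f g : L1 f -> L1 g ->
  ba_density (fun x => a * f x + g x) = a *: ba_density f + ba_density g.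
Proof.
move=> fi gi; apply: ba_eq => A mA.
rewrite baD baZ !ba_densityE//; last by apply: L1D => //; exact: L1Z.
have fA : gamma.-integrable A (EFin \o f) by exact: integrableS fi.
rewrite RintegralD ?RintegralZl//; last exact: integrableS gi.
by apply: integrableS (L1Z a fi).
Qed.

(** Over any partition, the integrals of the absolute value of [g] on the pieces add up to the
    right-hand side. So functionals on [ba] pull back to L1 without increase of norm. *)
Lemma ba_density_norm g : L1 g -> `|ba_density g| <= \int[gamma]_x `|g x|.
Proof.
move=> ig; have ing : L1 (fun x => `|g x|) by exact: integrable_norm.
apply: tv_norm_le => _ [n [F [mF tF UF ->]]].
apply: (@le_trans _ _ (\sum_(i < n) ba_density (fun x => `|g x|) (F i))).
  apply: ler_sum => i _; rewrite !ba_densityE//.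
  by apply: le_normr_Rintegral => //; exact: integrableS ig.
rewrite -ba_bigsetU// ba_densityE//; last exact: bigsetU_measurable.
have -> : \big[setU/set0]_(i < n) F i = [set: T].
  rewrite -UF; apply/seteqP; split => x.
    by rewrite -bigcup_seq => -[i _ Fix]; exists i.
  by move=> [i _ Fix]; rewrite -bigcup_seq; exists i => //=; rewrite mem_index_enum.
by [].
Qed.

Lemma ba_density_probability (mu : probability T R) : mu `<< gamma ->
  exists2 f, L1 f & ba_of_probability mu = ba_density f /\
    forall phi, bounded_measurable phi ->
      \int[gamma]_x (phi x * f x) = \int[mu]_x phi x.
Proof.
move=> mug.
pose RN := Radon_Nikodym (charge_of_finite_measure mu) gamma.
have mug' : charge_of_finite_measure mu `<< gamma by exact: mug.
pose f x := fine (RN x).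
have fE x : (f x)%:E = RN x by rewrite /f fineK// Radon_Nikodym_fin_num.
have fi : L1 f.
  apply: eq_integrable (Radon_Nikodym_integrable mug') => //.
  by move=> x _; rewrite /= fE.
exists f => //; split.
  apply: ba_eq => A mA; rewrite ba_densityE// /Rintegral.
  under eq_integral do rewrite fE.
  rewrite -Radon_Nikodym_integral//=.
  by rewrite /ba_of_probability_fun asboolT.
move=> phi bphi; rewrite /Rintegral; under eq_integral do rewrite EFinM fE.
rewrite (@Radon_Nikodym_change_of_variables _ _ _ mu gamma mug (EFin \o phi))//.
exact: integrable_bounded.
Qed.

(** A functional on [ba] need not be integration against a function; its composite with [ba_density]
    is one, by [L1_dual], and dominated probabilities are in the range of [ba_density]. *)
Lemma ba_dual_test (l : {linear ba T R -> R^o}) : (forall s, l s <= `|s|) ->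
  exists2 phi : T -> R,
    measurable_fun [set: T] phi /\ (forall x, `|phi x| <= 1) &
    forall mu : probability T R, mu `<< gamma ->
      l (ba_of_probability mu) = \int[mu]_x phi x.
Proof.
move=> lle.
have lnorm s : `|l s| <= `|s|.
  by rewrite ler_norml lle andbT lerNl -raddfN (le_trans (lle _))// normrN.
pose L g := l (ba_density g) : R.
have Llin : L1_linear gamma L.
  by move=> a f g fi gi; rewrite /L ba_densityD// linearP.
have Lbd : L1_bounded gamma 1 L.
  by move=> g ig; rewrite mul1r (le_trans (lnorm _))// ba_density_norm.
have [phi [mphi phi1 Lphi]] := L1_dual Llin Lbd.
exists phi => // mu /ba_density_probability[f fi [-> <-]]; first exact: Lphi.
by split => //; exists 1.
Qed.

End ba_density.

(** * Domination of a sigma-finite measure by a finite one *)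

Definition finite_measure_of d (T : measurableType d) (R : realType)
  (rho : {measure set T -> \bar R}) & fin_num_fun rho : set T -> \bar R := rho.

Section finite_measure_of.
Context d (T : measurableType d) (R : realType).
Variables (rho : {measure set T -> \bar R}) (rhofin : fin_num_fun rho).

HB.instance Definition _ := Measure.on (finite_measure_of rhofin).
HB.instance Definition _ :=
  Measure_isFinite.Build d T R (finite_measure_of rhofin) rhofin.

End finite_measure_of.

(** The weights are small enough that the [n]-th term has mass at most [1 / 2 ^ n.+1], yet positive,
    so that a [rho]-null set meets every [F n] in a [gamma]-null set. *)
Lemma sigma_finite_dominated_finite d (T : measurableType d) (R : realType)
    (gamma : {sigma_finite_measure set T -> \bar R}) :
  exists rho : {finite_measure set T -> \bar R}, gamma `<< rho.
Proof.
have [F FT /all_and2[mF Foo]] := sigma_finiteT gamma.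
(* The series of the [c n * gamma (A `&` F n)] is a measure of mass at most 1. *)
pose c n : R := 1 / (2 ^ n.+1)%:R / (1 + fine (gamma (F n))).
have den0 n : 0 < 1 + fine (gamma (F n)) by rewrite ltr_pwDl// fine_ge0.
have c0 n : 0 < c n by rewrite divr_gt0// divr_gt0// ltr0n expn_gt0.
pose m n : {measure set T -> \bar R} :=
  mscale (NngNum (ltW (c0 n))) (mrestr gamma (mF n)).
pose rho : {measure set T -> \bar R} := mseries m 0.
have mE n A : m n A = ((c n)%:E * gamma (A `&` F n))%E by [].
have rhofin : fin_num_fun rho.
  move=> A mA; rewrite ge0_fin_numE ?measure_ge0//.
  apply: (@le_lt_trans _ _ 1%:E); last exact: ltry.
  apply: le_trans (@epsilon_trick0 R 1 xpredT ler01).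
  apply: lee_nneseries => [n _|n _]; first by [].
  have gF : gamma (F n) \is a fin_num.
    by rewrite ge0_fin_numE ?measure_ge0//; exact: Foo.
  rewrite mE (@le_trans _ _ ((c n)%:E * gamma (F n))%E)//.
    apply: lee_wpmul2l; first by rewrite lee_fin ltW.
    by apply: le_measure; rewrite ?inE//; exact: measurableI.
  have e0 : 0 < 1 / (2 ^ n.+1)%:R :> R by rewrite divr_gt0// ltr0n expn_gt0.
  rewrite -[gamma (F n)]fineK// -EFinM lee_fin /c.
  set e := 1 / (2 ^ n.+1)%:R in e0 *; rewrite -mulrA ger_pMr//.
  by rewrite mulrC ler_pdivrMr// mul1r lerDr.
exists (finite_measure_of rhofin).
apply/null_content_dominatesP => A mA A0.
have AF n : gamma (A `&` F n) = 0%E.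
  have : (m n A <= 0)%E.
    rewrite -A0; apply: le_trans (nneseries_lim_ge n.+1 _) => //.
    by rewrite big_nat_recr//= leeDr// sume_ge0.
  rewrite mE pmule_rle0 ?lte_fin// => h; apply/eqP.
  by rewrite eq_le h measure_ge0.
apply/eqP; rewrite eq_le measure_ge0 andbT.
apply: le_trans (@measure_sigma_subadditive _ _ _ gamma A (fun n => A `&` F n) _ _ _) _.
- by move=> n; exact: measurableI.
- by [].
- by rewrite -setI_bigcupr -FT setIT.
- by rewrite eseries0 => [|n _ _]; [|exact: AF].
Qed.

(** * Norm and weak-* topologies, distance of the hulls and risk *)

Lemma lipschitz_continuous (R : realType) (V : normedModType R) (l : V -> R) C :
  (forall s t, `|l s - l t| <= C * `|s - t|) -> continuous l.
Proof.
move=> lC s; have C1 : 0 < `|C| + 1 by rewrite ltr_wpDl.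
apply/cvgrPdist_le => e e0; apply/nbhs_normP.
exists (e / (`|C| + 1)); first exact: divr_gt0.
move=> t /= /ltW; rewrite ler_pdivlMr// mulrC; apply: le_trans.
rewrite (le_trans (lC _ _))// ler_wpM2r//.
by rewrite (le_trans (ler_norm _))// lerDl.
Qed.

Section hulls.
Context d (T : measurableType d) (R : realType).
Implicit Types (P Q : set (probability T R)) (f : T -> R).

Lemma convex_hull_convex P (x y : ba T R) (t : R) : 0 <= t <= 1 ->
  convex_hull P x -> convex_hull P y -> convex_hull P (t *: x + (1 - t) *: y).
Proof.
move=> t01 Px Py A [cA PA].
have := cA x y (Itv01 (andP t01).1 (andP t01).2).
rewrite !inE; apply; [exact: Px|exact: Py].
Qed.

Lemma weak_star_continuous f : bounded_measurable f ->
  continuous (fun s : weak_star T R => ba_integral s f).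
Proof.
move=> bf; pose i : @bounded_measurable d T R := exist _ f (mem_set bf).
pose w (mu : ba T R) : {ptws @bounded_measurable d T R -> R} :=
  fun i => ba_integral mu (set_val i).
have wi : continuous (fun s : weak_star T R => (w s) i).
  move=> s; apply: (@continuous_comp _ _ _ (w : weak_star T R -> _) (fun h => h i)).
    exact: initial_continuous.
  exact: proj_continuous.
exact: wi.
Qed.

Lemma ba_integralB (s t : ba T R) f : bounded_measurable f ->
  ba_integral (s - t) f = ba_integral s f - ba_integral t f.
Proof.
by move=> bf; rewrite addrC -scaleN1r ba_integralD// mulN1r addrC.
Qed.

Lemma ba_integral_continuous f : bounded_measurable f ->
  continuous (fun s : ba T R => ba_integral s f).
Proof.
move=> bf; have [mf [C fC]] := bf.
apply: (@lipschitz_continuous R (ba T R) _ `|C|) => s t.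
rewrite -ba_integralB//; apply: ba_integral_le => // x.
by rewrite (le_trans (fC x))// ler_norm.
Qed.

(** The weak-* topology is initial for the integrals of bounded measurable functions, so continuity
    is checked on each of them, where it is a Lipschitz bound. *)
Lemma norm_weak_star_continuous : continuous (id : ba T R -> weak_star T R).
Proof.
apply: continuous_comp_initial.
pose w (mu : ba T R) : {ptws @bounded_measurable d T R -> R} :=
  fun i => ba_integral mu (set_val i).
suff cw : continuous w by exact: cw.
move=> s; have FF0 : Filter (nbhs s) by exact: nbhs_filter.
have FF : Filter (w @ s) by apply: fmap_filter.
apply/(cvg_sup _ (w s)) => i.
apply: (@continuous_comp_initial _ (ba T R) R (fun h => h i) w).
by apply: ba_integral_continuous; exact: (set_mem (valP i)).
Qed.

Lemma closed_convex_hull_weak_star P :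
  closed_convex_hull P `<=` weak_star_closed_convex_hull P.
Proof.
by move=> s Ps B /norm_weak_star_continuous; exact: Ps.
Qed.

(** The inequality cuts out a convex weak-* closed set. Taking [c] to be 1 or -1 gives upper and
    lower bounds on the integral. *)
Lemma weak_star_hull_le P f c a : bounded_measurable f ->
  (forall mu, P mu -> c * \int[mu]_x f x <= a) ->
  forall s, weak_star_closed_convex_hull P s -> c * ba_integral s f <= a.
Proof.
move=> bf Pa.
pose H : set (weak_star T R) := [set s | c * ba_integral s f <= a].
have hullH : convex_hull P `<=` H.
  apply: smallest_sub.
    move=> x y t; rewrite !inE /H /= => xH yH.
    have t0 : 0 <= t%:num by [].
    have t1 : 0 <= 1 - t%:num by rewrite subr_ge0.
    (* The added 0 brings both terms to the shape of [ba_integralD]. *)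
    have -> : conv t (x : convex_lmodType (ba T R)) y =
      t%:num *: (x : ba T R) + ((1 - t%:num) *: (y : ba T R) + 0) :> ba T R.
      by rewrite addr0.
    rewrite !ba_integralD//.
    have -> : ba_integral (0 : ba T R) f = 0 by rewrite -(subrr x) ba_integralB// subrr.
    have := ler_wpM2l t0 xH; have := ler_wpM2l t1 yH; lra.
  by move=> _ [mu Pmu <-]; rewrite /H/= ba_integral_probability//; exact: Pa.
have cH : closed H.
  apply: (@preimage_closed (weak_star T R) R (fun s : weak_star T R => c * ba_integral s f)
    [set x : R | x <= a]); last exact: closed_le.
  move=> s _; apply: (@continuous_comp (weak_star T R) R R
    (fun s => ba_integral s f) ( *%R c)); last exact: mulrl_continuous.
  exact: weak_star_continuous.
by move=> s Ps; apply: cH; exact: (@closureS (weak_star T R) _ _ hullH).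
Qed.

Lemma dTV_set_le (S S' : set (ba T R)) s t : S s -> S' t ->
  dTV_set S S' <= dTV s t.
Proof.
move=> Ss St; apply: ge_inf; last by exists s => //; exists t.
by exists 0 => _ [x _ [y _ <-]]; rewrite mulr_ge0// invr_ge0.
Qed.

Lemma le_dTV_set (S S' : set (ba T R)) a : S !=set0 -> S' !=set0 ->
  (forall s t, S s -> S' t -> a <= dTV s t) -> a <= dTV_set S S'.
Proof.
move=> [s Ss] [t St] h; apply: lb_le_inf.
  by exists (dTV s t); exists s => //; exists t.
by move=> _ [x Sx [y Sy <-]]; exact: h.
Qed.

Lemma convex_hull_nonempty P : P !=set0 -> convex_hull P !=set0.
Proof.
by move=> [mu Pmu]; exists (ba_of_probability mu) => A [_]; apply; exists mu.
Qed.

Lemma closed_convex_hull_nonempty P : P !=set0 -> closed_convex_hull P !=set0.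
Proof.
by move=> /convex_hull_nonempty[s Ps]; exists s => B /nbhs_singleton Bs; exists s.
Qed.

Lemma expectation_Rintegral (mu : probability T R) f : bounded_measurable f ->
  'E_mu[f]%E = (\int[mu]_x f x)%:E.
Proof.
move=> bf; rewrite unlock /Rintegral fineK//.
by apply: integrable_fin_num => //; exact: integrable_bounded.
Qed.

Lemma test_bounded_measurable f : test f -> bounded_measurable f.
Proof.
move=> [mf f01]; split => //; exists 1 => x.
by have /andP[f0 f1] := f01 x; rewrite ger0_norm.
Qed.

Lemma expectation_compl (mu : probability T R) f : test f ->
  'E_mu[fun x => (1 - f x)%R]%E = (1 - \int[mu]_x f x)%:E.
Proof.
move=> tf; have bf := test_bounded_measurable tf.
rewrite expectation_Rintegral; last first.
  apply: test_bounded_measurable; split; first by apply: measurable_funB => //; case: tf.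
  by move=> x; case: tf => _ /(_ x) /andP[]; lra.
rewrite RintegralB//; [|exact: finite_measure_integrable_cst|exact: integrable_bounded].
rewrite Rintegral_cst//; have /(congr1 fine) /= -> := probability_setT mu.
by rewrite mulr1.
Qed.

Lemma Rintegral_test_itv01 (mu : probability T R) f : test f ->
  0 <= \int[mu]_x f x <= 1.
Proof.
move=> tf; apply/andP; split.
  by apply: Rintegral_ge0 => x _; case: tf => _ /(_ x) /andP[].
rewrite -subr_ge0 -lee_fin -expectation_compl// unlock.
apply: integral_ge0 => x _; rewrite lee_fin subr_ge0.
by case: tf => _ /(_ x) /andP[].
Qed.

Lemma risk_ge P Q phi : P !=set0 -> Q !=set0 -> test phi ->
  ((1 - dTV_set (weak_star_closed_convex_hull P)
               (weak_star_closed_convex_hull Q))%:E <= risk phi P Q)%E.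
Proof.
move=> P0 Q0 tphi; have bphi := test_bounded_measurable tphi.
pose A := [set \int[mu]_x phi x | mu in P].
pose B := [set 1 - \int[nu]_x phi x | nu in Q].
have supA : has_sup A.
  split; first by have [mu Pmu] := P0; exists (\int[mu]_x phi x); exists mu.
  by exists 1 => _ [mu _ <-]; have /andP[] := Rintegral_test_itv01 mu tphi.
have supB : has_sup B.
  split; first by have [nu Qnu] := Q0; exists (1 - \int[nu]_x phi x); exists nu.
  by exists 1 => _ [nu _ <-]; have /andP[? _] := Rintegral_test_itv01 nu tphi; lra.
have -> : risk phi P Q = (sup A + sup B)%:E.
  rewrite EFinD /risk -!ereal_sup_EFin; [|by case: supB|by case: supB|by case: supA|by case: supA].
  rewrite !image_comp; congr (ereal_sup _ + ereal_sup _)%E;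
    apply: eq_imagel => mu _ /=.
    exact: expectation_Rintegral.
  exact: expectation_compl.
rewrite lee_fin lerBlDr -lerBlDl; apply: le_dTV_set.
- have [s /closed_convex_hull_weak_star Ps] := closed_convex_hull_nonempty P0.
  by exists s.
- have [s /closed_convex_hull_weak_star Qs] := closed_convex_hull_nonempty Q0.
  by exists s.
(* Centring [phi] makes [|f| <= 1], so the integrals of [f] against [s] and [t] differ by at most
   [|s - t|]; those of [phi] then differ by half of it, that is, by [dTV s t]. *)
pose f x := 2 * phi x - 1.
have bf : bounded_measurable f.
  split; first by apply: measurable_funB => //; apply: measurable_funM => //; case: tphi.
  by exists 1 => x; case: tphi => _ /(_ x) /andP[? ?]; rewrite ler_norml /f; lra.
have f1 x : `|f x| <= 1.
  by case: tphi => _ /(_ x) /andP[? ?]; rewrite ler_norml /f; lra.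
have fE (mu : probability T R) : \int[mu]_x f x = 2 * \int[mu]_x phi x - 1.
  rewrite /f RintegralB//; last exact: finite_measure_integrable_cst.
    rewrite RintegralZl//; last exact: integrable_bounded.
    rewrite Rintegral_cst//; have /(congr1 fine) /= -> := probability_setT mu.
    by rewrite mulr1.
  exact: L1Z (integrable_bounded _ bphi).
move=> s t Ps Qt.
have fs : 1 * ba_integral s f <= 2 * sup A - 1.
  apply: (weak_star_hull_le bf _ Ps) => mu Pmu; rewrite fE mul1r lerD2r.
  by rewrite ler_pM2l//; apply: sup_upper_bound => //; exists mu.
have ft : (- 1) * ba_integral t f <= 2 * sup B - 1.
  apply: (weak_star_hull_le bf _ Qt) => nu Qnu; rewrite fE.
  have : 1 - \int[nu]_x phi x <= sup B by apply: sup_upper_bound => //; exists nu.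
  lra.
have := ba_integral_le (s - t) bf ler01 f1.
rewrite ba_integralB// mul1r ler_norml => /andP[st _].
rewrite /dTV; lra.
Qed.

Lemma exists_test_risk_le P Q (rho : {finite_measure set T -> \bar R}) :
  P !=set0 -> Q !=set0 -> (forall mu, P mu -> mu `<< rho) ->
  (forall nu, Q nu -> nu `<< rho) ->
  exists2 phi : T -> R, test phi &
    (risk phi P Q <= (1 - dTV_set (closed_convex_hull P)
                                  (closed_convex_hull Q))%:E)%E.
Proof.
move=> P0 Q0 Prho Qrho.
set delta := dTV_set _ _.
pose C : set (ba T R) :=
  [set c | exists2 s, convex_hull P s & exists2 t, convex_hull Q t & c = t - s].
have [|||l [lnorm lC]] :=
    @convex_norm_separation R (ba T R) C (2 * delta).
- have [s Ps] := convex_hull_nonempty P0.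
  have [t Qt] := convex_hull_nonempty Q0.
  by exists (t - s); exists s => //; exists t.
- move=> _ _ u u01 [s Ps [t Qt ->]] [s' Ps' [t' Qt' ->]].
  exists (u *: s + (1 - u) *: s'); first exact: convex_hull_convex.
  exists (u *: t + (1 - u) *: t'); first exact: convex_hull_convex.
  by rewrite !scalerBr opprD addrACA.
(* [C] is built from the hulls before closure, which lie in the closed ones over which [delta] is an
   infimum. *)
- move=> _ [s Ps [t Qt ->]]; have : delta <= dTV s t.
    by apply: dTV_set_le => B /nbhs_singleton Bs; [exists s|exists t].
  by rewrite /dTV distrC; lra.
have [phi0 [mphi0 phi01] lphi0] := @ba_dual_test _ _ _ rho l lnorm.
(* Maps [-1, 1] to [0, 1]; the factor one half turns the gap [2 * delta] of [l] into [delta]. *)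
pose phi x := 2^-1 * phi0 x + 2^-1.
have tphi : test phi.
  split; first by apply: measurable_funD => //; exact: measurable_funM.
  by move=> x; have := phi01 x; rewrite /phi ler_norml => /andP[? ?]; lra.
have bphi := test_bounded_measurable tphi.
have bphi0 : bounded_measurable phi0 by split => //; exists 1.
have phiE (mu : probability T R) :
    \int[mu]_x phi x = 2^-1 * \int[mu]_x phi0 x + 2^-1.
  rewrite /phi RintegralD//; last exact: finite_measure_integrable_cst.
    rewrite RintegralZl//; last exact: integrable_bounded.
    rewrite Rintegral_cst//; have /(congr1 fine) /= -> := probability_setT mu.
    by rewrite mulr1.
  exact: L1Z (integrable_bounded _ bphi0).
have sep mu nu : P mu -> Q nu ->
    delta <= \int[nu]_x phi x - \int[mu]_x phi x.
  move=> Pmu Qnu; rewrite !phiE -!lphi0; [|exact: Prho|exact: Qrho].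
  have : 2 * delta <= l (ba_of_probability nu - ba_of_probability mu).
    apply: lC; exists (ba_of_probability mu); first by move=> ? [_]; apply; exists mu.
    by exists (ba_of_probability nu) => // ? [_]; apply; exists nu.
  rewrite raddfB /=; lra.
pose A := [set \int[mu]_x phi x | mu in P].
have ubA nu : Q nu -> ubound A (\int[nu]_x phi x - delta).
  by move=> Qnu _ [mu Pmu <-]; have := sep mu nu Pmu Qnu; lra.
have A0 : A !=set0.
  by have [mu Pmu] := P0; exists (\int[mu]_x phi x); exists mu.
exists phi => //; rewrite /risk.
(* Since [sep] holds for all pairs, [sup A] splits the bound into one on [P] alone and one on [Q]
   alone. *)
rewrite (_ : (1 - delta)%:E = ((sup A)%:E + (1 - delta - sup A)%:E)%E); last first.
  by rewrite -EFinD; congr EFin; ring.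
apply: leeD; apply: ge_ereal_sup => _ [mu Hmu <-].
- rewrite expectation_Rintegral// lee_fin; apply: sup_upper_bound.
    split=> //; have [nu Qnu] := Q0.
    by exists (\int[nu]_x phi x - delta); exact: ubA.
  by exists mu.
- rewrite expectation_compl// lee_fin.
  have : sup A <= \int[mu]_x phi x - delta by apply: ge_sup => //; exact: ubA.
  lra.
Qed.

End hulls.

Theorem proposition1p6 (d : measure_display) (T : measurableType d)
    (R : realType) (P Q : set (probability T R)) :
  P !=set0 -> Q !=set0 ->
  (exists gamma : {sigma_finite_measure set T -> \bar R},
    (forall mu, P mu -> mu `<< gamma) /\ (forall nu, Q nu -> nu `<< gamma)) ->
  dTV_set (closed_convex_hull P) (closed_convex_hull Q) =
    dTV_set (weak_star_closed_convex_hull P) (weak_star_closed_convex_hull Q) /\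
  exists phi : T -> R,
    test phi /\ risk phi P Q = minimax_risk P Q.
Proof.
move=> P0 Q0 [gamma [Pgamma Qgamma]].
have [rho gamma_rho] := sigma_finite_dominated_finite gamma.
have [phi tphi phi_le] : exists2 phi : T -> R, test phi &
    (risk phi P Q <= (1 - dTV_set (closed_convex_hull P)
                                  (closed_convex_hull Q))%:E)%E.
  by apply: (@exists_test_risk_le _ _ _ _ _ rho) => // mu Hmu;
    apply: null_dominates_trans gamma_rho; [exact: Pgamma|exact: Qgamma].
have le_dTV : dTV_set (weak_star_closed_convex_hull P) (weak_star_closed_convex_hull Q)
    <= dTV_set (closed_convex_hull P) (closed_convex_hull Q).
  apply: le_dTV_set; [exact: closed_convex_hull_nonempty..|move=> s t Ps Qt].
  by apply: dTV_set_le; exact: closed_convex_hull_weak_star.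
have eq_dTV : dTV_set (closed_convex_hull P) (closed_convex_hull Q) =
    dTV_set (weak_star_closed_convex_hull P) (weak_star_closed_convex_hull Q).
  (* The risk of [phi] is at least 1 minus the weak-* distance and at most 1 minus the norm
     distance. *)
  apply/eqP; rewrite eq_le le_dTV andbT.
  by have := le_trans (risk_ge P0 Q0 tphi) phi_le; rewrite lee_fin; lra.
split => //; exists phi; split => //.
(* With both distances equal, the lower bound valid for every test is the upper bound reached by
   [phi]. *)
apply/eqP; rewrite eq_le; apply/andP; split.
  apply: le_ereal_inf_tmp => _ [psi tpsi <-].
  by rewrite (le_trans phi_le)// eq_dTV risk_ge.
by apply: ereal_inf_lbound; exists phi.
Qed.
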